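(* Let $C_5$ be the $5$-cycle graph and let $\Gamma_8$ be the simple graph with vertex set $\{1,\dots,8\}$ and the ten edges $$\{4,5\},\{5,1\},\{1,2\},\{2,3\},\{3,4\},\{2,7\},\{7,8\},\{8,6\},\{3,6\},\{1,6\}.$$ Then, for $0<|q|<1$, $$H_{C_5}(q)=\frac{q^{-1}}{(q)_\infty^2}\sum_{n\ge1}\frac{nq^n}{1-q^n},\qquad H_{\Gamma_8}(q)=\frac{q^{-1}}{(q)_\infty^3}\sum_{n\ge1}\frac{n^2q^n}{1-q^n}.$$
   Context: Notation: $(q)_n=\prod_{j=1}^n(1-q^j)$, $(q)_\infty=\prod_{j\ge1}(1-q^j)$. For a simple graph $\Gamma$ with vertices $1,\dots,r$ and symmetric adjacency matrix $C_\Gamma$, the graph series is $$H_\Gamma(q):=\sum_{\boldsymbol{n}=(n_1,\dots,n_r)\in\mathbb{N}_0^r}\frac{q^{\frac12\boldsymbol{n}C_\Gamma\boldsymbol{n}^T+n_1+\cdots+n_r}}{(q)_{n_1}\cdots(q)_{n_r}},$$ i.e. the quadratic part of the exponent is $\sum n_kn_j$ over all (unordered) edges $\{k,j\}$ of $\Gamma$. *)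

(* Defs.v *)
From HB Require Import structures.
From mathcomp Require Import all_boot all_order all_algebra.
From mathcomp Require Import all_classical all_reals all_analysis.
From mathcomp Require Import complex.
From mathcomp Require Import showcase.summability.
Set Implicit Arguments.
Unset Strict Implicit.
Unset Printing Implicit Defensive.
Import Order.TTheory GRing.Theory Num.Theory.
Import numFieldNormedType.Exports.
Local Open Scope classical_set_scope.
Local Open Scope ring_scope.

(* [R[i]] carries no topology in the real-closed library; give it the one
   induced by its modulus (a complex number that is real and nonnegative). *)
HB.instance Definition _ (R : realType) := NormedModule.copy R[i] R[i]^o.

Record simple_graph (r : nat) := SimpleGraph {
  adj :> rel 'I_r;
  adj_sym : symmetric adj;
  adj_irr : irreflexive adj }.

Definition adjmx r (G : simple_graph r) : 'M[nat]_r :=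
  \matrix_(i, j) nat_of_bool (G i j).

(* Vertices are named 1, ..., r in edge lists: [i : 'I_r] is vertex [i.+1]. *)
Definition edge_rel r (E : seq (nat * nat)) : rel 'I_r :=
  fun i j => (i != j) && (((i.+1, j.+1) \in E) || ((j.+1, i.+1) \in E)).

Lemma edge_rel_sym r E : symmetric (@edge_rel r E).
Proof. by move=> i j; rewrite /edge_rel eq_sym orbC. Qed.

Lemma edge_rel_irr r E : irreflexive (@edge_rel r E).
Proof. by move=> i; rewrite /edge_rel eqxx. Qed.

Definition graph_of_edges r (E : seq (nat * nat)) : simple_graph r :=
  SimpleGraph (@edge_rel_sym r E) (@edge_rel_irr r E).

Definition C5 : simple_graph 5 :=
  graph_of_edges 5 [:: (1, 2); (2, 3); (3, 4); (4, 5); (5, 1)]%N.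

Definition Gamma8 : simple_graph 8 :=
  graph_of_edges 8 [:: (4, 5); (5, 1); (1, 2); (2, 3); (3, 4);
                       (2, 7); (7, 8); (8, 6); (3, 6); (1, 6)]%N.

(* n C n^T is even, see [quad_formE], so halving in [nat] is exact. *)
Definition graph_exponent r (G : simple_graph r) (n : 'rV[nat]_r) : nat :=
  (((n *m adjmx G *m n^T) ord0 ord0)./2 + \sum_(i < r) n ord0 i)%N.

Lemma quad_formE r (G : simple_graph r) (n : 'rV[nat]_r) :
  (n *m adjmx G *m n^T) ord0 ord0 =
  (\sum_(p : 'I_r * 'I_r | (p.1 < p.2)%N && G p.1 p.2)
     n ord0 p.1 * n ord0 p.2).*2%N.
Proof.
have -> : (n *m adjmx G *m n^T) ord0 ord0 =
          (\sum_(p : 'I_r * 'I_r | G p.1 p.2) n ord0 p.1 * n ord0 p.2)%N.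
  rewrite !mxE [RHS]big_mkcond /=.
  rewrite -(pair_bigA _ (fun i j => if G i j then n ord0 i * n ord0 j else 0))%N.
  rewrite exchange_big; apply: eq_bigr => j _; rewrite !mxE big_distrl.
  by apply: eq_bigr => i _; rewrite !mxE; case: (G i j);
    rewrite /= ?mulr1 ?mulr0 ?mul0r.
rewrite (bigID (fun p : 'I_r * 'I_r => p.1 < p.2)%N) /= -addnn.
congr addn; first by apply: eq_bigl => p; rewrite andbC.
rewrite (reindex_inj (can_inj (@swap_pairK _ _))) /=.
apply: eq_big => [[i j]|[i j] _] /=; last exact: mulnC.
have [<-|ij] := eqVneq i j; first by rewrite adj_irr ltnn andbF.
by rewrite adj_sym -leqNgt leq_eqVlt (inj_eq val_inj) (negPf ij) andbC.
Qed.

Section QSeries.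
Variable R : realType.
Implicit Type q : R[i].

Definition qpoch q (n : nat) : R[i] := \prod_(1 <= j < n.+1) (1 - q ^+ j).

Definition qpoch_inf q : R[i] := limn (qpoch q).

Definition graph_term r (G : simple_graph r) q (n : 'rV[nat]_r) : R[i] :=
  q ^+ graph_exponent G n / \prod_(i < r) qpoch q (n ord0 i).

(* Unconditional summation over N^r: [sum] and [partial_sum] are taken along
   the filter [totally] of finite sets of multi-indices ordered by inclusion. *)
Definition graph_series r (G : simple_graph r) q : R[i] :=
  summability.sum (graph_term G q).

End QSeries.

(* Main.v *)
Require Import Defs.
From mathcomp Require Import all_boot all_order all_algebra.
From mathcomp Require Import all_classical all_reals all_analysis.
From mathcomp Require Import complex.
From mathcomp Require Import showcase.summability.
From mathcomp Require Import finmap ring zify.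
Import Order.TTheory GRing.Theory Num.Theory.
Import numFieldNormedType.Exports.
Local Open Scope classical_set_scope.
Local Open Scope ring_scope.

(** The quadratic part of the exponent is linear in each single n_v, so a
    vertex whose neighbours carry the total weight m can be summed out by
    Euler's identity [has_sum_qexp],
      sum_n q^(n(m+1)) / (q)_n = (q)_m / (q)_oo.
    Vertices that are pairwise non-adjacent can be treated this way
    independently of each other: two of them in C_5 and three in Gamma_8,
    which accounts for the powers of (q)_oo.  The factors (q)_m so created
    make further sums instances of the q-binomial theorem
    [has_sum_qbinomial],
      sum_c q^(c(b+1)) (q)_(a+c) / (q)_c = (q)_a (q)_b / (q)_(a+b+1),
    after which all remaining finite products cancel.  What is left is
      sum_(a,b) q^(a+b) / (1 - q^(a+b+1))                         for C_5,
      sum_(a,b,c) q^(a+b+c) / ((1 - q^(a+b+c+1)) (1 - q^(a+b+1))) for Gamma_8.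
    Collecting the terms with a + b = n, of which there are n + 1, finishes the
    case of C_5.

    For Gamma_8, put x_n = q^n / (1 - q^n) and collect the terms with
    a + b + 1 = M and a + b + c + 1 = N.  It remains to see that
      sum_(M <= N) M x_N (1 + x_M) = sum_N N^2 x_N.
    This follows from x_M x_K = x_(M+K) (1 + x_M + x_K) by computing
    sum_(M,K) M x_M x_K in two ways, see [lambert_double_sum].

    All these rearrangements are legitimate because the original multiple sums
    converge absolutely: their terms are dominated by products of the terms
    q^n / (q)_n of a convergent series.  Summation over an arbitrary index type
    is handled by [has_sum], whose Fubini property [has_sum_fubini] transports
    a known total through every step; so, among the multiple sums, absolute
    convergence has to be checked only for the two original ones and for the
    double sums of the last identity. *)

Set Implicit Arguments.
Unset Strict Implicit.
Unset Printing Implicit Defensive.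

(** * Unconditional sums over an arbitrary index type *)

Section UnconditionalSums.
Variable K : numFieldType.

(** Convergence of the net of finite partial sums, with duplicate-free lists in
    the role of finite sets, so that it makes sense for every [eqType] and for
    both real and complex values. *)
Definition has_sum (I : eqType) (f : I -> K) (s : K) : Prop :=
  forall e : K, 0 < e -> exists A : seq I, forall B : seq I,
    uniq B -> {subset A <= B} -> `|s - \sum_(i <- B) f i| < e.

Definition abs_summable (I : eqType) (f : I -> K) : Prop :=
  exists M : K, forall B : seq I, uniq B -> \sum_(i <- B) `|f i| <= M.

Lemma eq_has_sum (I : eqType) (f g : I -> K) s :
  f =1 g -> has_sum f s -> has_sum g s.
Proof. by move=> /funext ->. Qed.

Lemma has_sum_unique (I : eqType) (f : I -> K) s t :
  has_sum f s -> has_sum f t -> s = t.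
Proof.
move=> fs ft; have [//|st] := eqVneq s t; exfalso.
have st0 : 0 < `|s - t| by rewrite normr_gt0 subr_eq0.
have e0 : 0 < `|s - t| / 2 by rewrite divr_gt0.
have [A hA] := fs _ e0; have [A' hA'] := ft _ e0.
have uB : uniq (undup (A ++ A')) by exact: undup_uniq.
have := hA _ uB; have := hA' _ uB; move: (\sum_(i <- _) _) => S h1 h2.
have : `|s - t| < `|s - t| / 2 + `|s - t| / 2.
  have -> : s - t = (s - S) - (t - S) by ring.
  apply: (le_lt_trans (ler_normB _ _)).
  have -> : s - S - (t - S) = s - t by ring.
  by apply: ltrD; [apply: h2|apply: h1] => x xA;
    rewrite mem_undup mem_cat xA ?orbT.
by rewrite -splitr ltxx.
Qed.

Lemma has_sumD (I : eqType) (f g : I -> K) s t :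
  has_sum f s -> has_sum g t -> has_sum (fun i => f i + g i) (s + t).
Proof.
move=> fs gt e e0; have e2 : 0 < e / 2 by rewrite divr_gt0.
have [A hA] := fs _ e2; have [A' hA'] := gt _ e2.
exists (A ++ A') => B uB sB; rewrite big_split/= opprD addrACA.
rewrite (le_lt_trans (ler_normD _ _))// [ltRHS]splitr ltrD//.
- by apply: hA => // x xA; apply: sB; rewrite mem_cat xA.
- by apply: hA' => // x xA; apply: sB; rewrite mem_cat xA orbT.
Qed.

Lemma has_sumZ (I : eqType) (f : I -> K) s c :
  has_sum f s -> has_sum (fun i => c * f i) (c * s).
Proof.
move=> fs e e0; have c0 : 0 < `|c| + 1 by rewrite ltr_wpDl.
have [A hA] := fs _ (divr_gt0 e0 c0).
exists A => B uB sB; rewrite -mulr_sumr -mulrBr normrM.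
have := hA _ uB sB; rewrite ltr_pdivlMr// => /(le_lt_trans _); apply.
by rewrite mulrC ler_wpM2l// lerDl.
Qed.

Lemma has_sumB (I : eqType) (f g : I -> K) s t :
  has_sum f s -> has_sum g t -> has_sum (fun i => f i - g i) (s - t).
Proof.
move=> fs gt; rewrite -[- t]mulN1r.
apply: eq_has_sum (has_sumD fs (has_sumZ (- 1) gt)) => i.
by rewrite mulN1r.
Qed.

Lemma has_sum_finite (I : eqType) (f : I -> K) (r : seq I) :
  uniq r -> (forall i, i \notin r -> f i = 0) ->
  has_sum f (\sum_(i <- r) f i).
Proof.
move=> ur f0 e e0; exists r => B uB sB.
rewrite [X in _ - X](bigID (mem r))/= [X in _ - (_ + X)]big1// addr0.
rewrite -[X in _ - X]big_filter (@perm_big _ _ _ _ [seq x <- B | x \in r] r).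
  by rewrite subrr normr0.
apply: uniq_perm => //; first exact: filter_uniq.
by move=> x; rewrite mem_filter/= andb_idr// => /sB.
Qed.

(** Used both to reindex along a bijection and to extend a sum by zero. *)
Lemma has_sum_inj (I J : eqType) (phi : I -> J) (g : J -> K) s :
  injective phi -> (forall j, (forall i, phi i <> j) -> g j = 0) ->
  has_sum (g \o phi) s -> has_sum g s.
Proof.
move=> phi_inj g0 gs e e0; have [A hA] := gs _ e0.
have psi j : {o : option I | oapp phi j o = j & (o = None -> forall i, phi i <> j)}.
  have [/cid[i ij]|nij] := pselect (exists i, phi i = j).
    by exists (Some i).
  by exists None => // _ i ij; apply: nij; exists i.
pose psi' j := s2val (psi j).
have psiK : ocancel psi' phi by move=> j; exact: (s2valP (psi j)).
exists (map phi A) => B uB sB.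
suff -> : \sum_(j <- B) g j = \sum_(i <- pmap psi' B) g (phi i).
  apply: hA; first exact: (pmap_uniq psiK).
  move=> i iA; rewrite mem_pmap; apply/mapP; exists (phi i).
    by apply: sB; apply: map_f.
  have := psiK (phi i); rewrite /psi'; case: (psi _) => -[i'|] /= h h0.
    by move: h => /phi_inj ->.
  by case: (h0 erefl i).
elim: B {uB sB} => [|j B IH]; first by rewrite !big_nil.
rewrite big_cons IH/=.
have := psiK j; rewrite /psi'; case: (psi j) => -[i'|] /= h h0 => [|_].
  by rewrite big_cons => ->.
by rewrite g0 ?add0r//; exact: h0.
Qed.

(** Given a finite set B of rows, truncate each of them to a finite set that is
    accurate up to e / (2 (#B + 1)) and contains the columns of the finite set
    A that controls the double sum.  The truncated rows together contain A as
    soon as B contains its projection. *)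
Lemma has_sum_fubini (I J : eqType) (f : I * J -> K) (g : I -> K) s :
  has_sum f s -> (forall i, has_sum (fun j => f (i, j)) (g i)) ->
  has_sum g s.
Proof.
move=> fs fg e e0; have e2 : 0 < e / 2 by rewrite divr_gt0.
have [A hA] := fs _ e2.
exists (map fst A) => B uB sB.
have n0 : 0 < (size B).+1%:R :> K by rewrite ltr0n.
have e3 : 0 < e / 2 / (size B).+1%:R by rewrite divr_gt0.
have [C hC] := choice (fun i => fg i _ e3).
pose D i := undup (C i ++ [seq p.2 | p <- A & p.1 == i]).
have uD : uniq [seq (i, j) | i <- B, j <- D i].
  apply: allpairs_uniq_dep => //; first by move=> i _; exact: undup_uniq.
  by move=> [i j] [i' j'] _ _ /= [-> ->].
have := hA _ uD; rewrite big_allpairs_dep/= => /(_ _)/wrap[].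
  move=> [i j] ijA; apply/allpairsPdep; exists i, j; split => //.
    by apply: sB; apply: (map_f fst ijA).
  rewrite mem_undup mem_cat; apply/orP; right; apply/mapP.
  by exists (i, j) => //; rewrite mem_filter/= eqxx.
set S := \sum_(i <- B) _ => hS.
have -> : s - \sum_(i <- B) g i = (s - S) - (\sum_(i <- B) g i - S) by ring.
rewrite (le_lt_trans (ler_normB _ _))// [ltRHS]splitr ltr_leD//.
rewrite -sumrB (le_trans (ler_norm_sum _ _ _))//.
apply: (@le_trans _ _ (\sum_(i <- B) e / 2 / (size B).+1%:R)).
  apply: ler_sum => i _; apply/ltW/hC; first exact: undup_uniq.
  by move=> j jC; rewrite mem_undup mem_cat jC.
rewrite big_const_seq count_predT iter_addr_0 -[leLHS]mulr_natr -mulrA ler_piMr//.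
  exact: ltW.
by rewrite mulrC ler_pdivrMr// mul1r ler_nat.
Qed.

Lemma ler_sum_subseq (I : eqType) (f : I -> K) (B D : seq I) :
  uniq B -> uniq D -> {subset B <= D} -> (forall i, 0 <= f i) ->
  \sum_(i <- B) f i <= \sum_(i <- D) f i.
Proof.
move=> uB uD sBD f0; rewrite [leRHS](bigID (mem B))/=.
rewrite -[X in _ <= X + _]big_filter (@perm_big _ _ _ _ [seq x <- D | x \in B] B).
  by rewrite lerDl; apply: sumr_ge0.
apply: uniq_perm => //; first exact: filter_uniq.
by move=> x; rewrite mem_filter/= andb_idr// => /sBD.
Qed.

Lemma abs_summable_le (I : eqType) (f g : I -> K) c :
  0 <= c -> (forall i, `|f i| <= c * `|g i|) ->
  abs_summable g -> abs_summable f.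
Proof.
move=> c0 fg [M hM]; exists (c * M) => B uB.
apply: (@le_trans _ _ (\sum_(i <- B) c * `|g i|)); first exact: ler_sum.
by rewrite -mulr_sumr ler_wpM2l// hM.
Qed.

Lemma abs_summable_prod (I J : eqType) (f : I -> K) (g : J -> K) :
  abs_summable f -> abs_summable g ->
  abs_summable (fun p : I * J => f p.1 * g p.2).
Proof.
move=> [M hM] [N hN]; exists (M * N) => B uB.
pose B1 := undup (map fst B); pose B2 := undup (map snd B).
apply: (@le_trans _ _
   (\sum_(p <- [seq (i, j) | i <- B1, j <- B2]) `|f p.1 * g p.2|)).
  apply: ler_sum_subseq => //.
    by apply: allpairs_uniq; rewrite ?undup_uniq// => -[? ?] [? ?] _ _ [-> ->].
  move=> [i j] ijB; apply/allpairsP; exists (i, j); rewrite !mem_undup.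
  by split => //; [apply: (map_f fst ijB)|apply: (map_f snd ijB)].
rewrite big_allpairs_dep/=.
under eq_bigr do (under eq_bigr do rewrite normrM; rewrite -mulr_sumr).
rewrite -mulr_suml ler_pM ?sumr_ge0 ?hM ?hN ?undup_uniq//.
Qed.

Lemma abs_summable_nat (f : nat -> K) M :
  (forall n, \sum_(i < n) `|f i| <= M) -> abs_summable f.
Proof.
move=> hM; exists M => B uB; apply: le_trans (hM (\max_(i <- B) i).+1).
rewrite -(big_mkord xpredT (fun i => `|f i|)).
apply: ler_sum_subseq => //; first exact: iota_uniq.
by move=> i iB; rewrite mem_index_iota/= ltnS; apply: leq_bigmax_seq.
Qed.

End UnconditionalSums.

(** * Absolute convergence implies convergence; passage to filters *)

Section Completeness.
Variable R : realType.

(** The sum is the supremum of the finite partial sums. *)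
Lemma nonneg_has_sum (I : eqType) (f : I -> R) :
  (forall i, 0 <= f i) -> abs_summable f -> exists s, has_sum f s.
Proof.
move=> f0 [M hM]; pose S := [set x : R |
  exists2 B : seq I, uniq B & x = \sum_(i <- B) f i].
have supS : has_sup S.
  split; first by exists 0; exists [::]; rewrite ?big_nil.
  exists M => _ [B uB ->]; rewrite (le_trans _ (hM _ uB))//.
  by apply: ler_sum => i _; exact: ler_norm.
exists (sup S) => e e0; have [_ [A uA ->] hA] := sup_adherent e0 supS.
exists A => B uB sB; rewrite ger0_norm.
  rewrite ltrBlDl -ltrBlDr (lt_le_trans hA)//; exact: ler_sum_subseq.
by rewrite subr_ge0; apply: sup_upper_bound => //; exists B.
Qed.

(** Write f as (|f| + f) - |f|, a difference of nonnegative families. *)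
Lemma real_abs_summable_has_sum (I : eqType) (f : I -> R) :
  abs_summable f -> exists s, has_sum f s.
Proof.
move=> sf.
have [t ft] : exists t, has_sum (fun i => `|f i|) t.
  apply: nonneg_has_sum => //.
  by apply: (abs_summable_le ler01 _ sf) => i; rewrite mul1r normr_id.
have [s fs] : exists s, has_sum (fun i => `|f i| + f i) s.
  apply: nonneg_has_sum => [i|]; first by rewrite -lerBlDl sub0r lerNnormlW.
  apply: (abs_summable_le (ler0n _ 2) _ sf) => i.
  by rewrite (le_trans (ler_normD _ _))// normr_id mulr_natl mulr2n.
exists (s - t); apply: eq_has_sum (has_sumB fs ft) => i.
by rewrite addrC addKr.
Qed.

Lemma abs_summable_has_sum (I : eqType) (f : I -> R[i]) :
  abs_summable f -> exists s, has_sum f s.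
Proof.
move=> [M hM].
have re_im (g : I -> R) :
    (forall i, (`|g i|)%:C%C <= `|f i|) -> exists s, has_sum g s.
  move=> gf; apply: real_abs_summable_has_sum; exists (complex.Re M) => B uB.
  have : (\sum_(i <- B) `|g i|)%:C%C <= M.
    by rewrite rmorph_sum/= (le_trans _ (hM _ uB))// ler_sum.
  by rewrite lecE => /andP[].
have [a fa] := re_im (fun i => complex.Re (f i)) (fun i => normc_ge_Re _).
have [b fb] : exists b, has_sum (fun i => complex.Im (f i)) b.
  apply: re_im => i; rewrite -normrN -ReiNIm (le_trans (normc_ge_Re _))//.
  by rewrite normrM (_ : `|'i%C| = 1) ?mulr1// normc_def/= expr0n add0r expr1n sqrtr1.
exists (a +i* b)%C => e e0.
have e2 : 0 < complex.Re e / 2.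
  by move: e0; rewrite ltcE => /andP[_ e0]; rewrite divr_gt0.
have [A hA] := fa _ e2; have [A' hA'] := fb _ e2.
exists (A ++ A') => B uB sB.
have sA : {subset A <= B} by move=> x xA; apply: sB; rewrite mem_cat xA.
have sA' : {subset A' <= B}.
  by move=> x xA; apply: sB; rewrite mem_cat xA orbT.
have {}hA := hA B uB sA; have {}hA' := hA' B uB sA'.
have sumE : \sum_(i <- B) f i = ((\sum_(i <- B) complex.Re (f i)) +i*
    (\sum_(i <- B) complex.Im (f i)))%C.
  elim: (B) => [|i B' IH]; first by rewrite !big_nil.
  by rewrite !big_cons IH; case: (f i).
set z := (_ - _).
have -> : z = (complex.Re z)%:C%C + 'i%C * (complex.Im z)%:C%C by exact: complexE.
rewrite (le_lt_trans (ler_normD _ _))// normrM.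
rewrite (_ : `|'i%C| = 1) ?mul1r; last by rewrite normc_def/= expr0n add0r expr1n sqrtr1.
have nR (x : R) : `|x%:C%C| = `|x|%:C%C :> R[i].
  by rewrite normc_def/= expr0n addr0 sqrtr_sqr.
have -> : e = (complex.Re e / 2)%:C%C + (complex.Re e / 2)%:C%C.
  rewrite -rmorphD/= -splitr RRe_real//; exact: gtr0_real.
by rewrite !nR ltrD// ltcR /z sumE.
Qed.

End Completeness.

#[local] Existing Instance totally_filter.

Section Topology.
Variable R : realType.

Lemma has_sum_totally (I : choiceType) (f : I -> R[i]) s :
  has_sum f s -> partial_sum f @ totally --> s.
Proof.
move=> fs; apply/cvgrPdist_lt => e e0; have [A hA] := fs _ e0.
exists [fset x in A]%fset => //= B /fsubsetP sB.
rewrite /partial_sum -(big_seq_fsetE _ _ xpredT f)/=; apply: hA => // x xA.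
by apply: sB; rewrite inE.
Qed.

Lemma has_sum_sum (I : choiceType) (f : I -> R[i]) s :
  has_sum f s -> summability.sum f = s.
Proof.
by move=> /has_sum_totally fs; apply: cvg_lim => //; exact: norm_hausdorff.
Qed.

Lemma has_sum_series (f : nat -> R[i]) s :
  has_sum f s -> \sum_(0 <= n < N) f n @[N --> \oo] --> s.
Proof.
move=> fs; apply/cvgrPdist_lt => e e0; have [A hA] := fs _ e0.
exists (\max_(i <- A) i).+1 => //= N leN; apply: hA; first exact: iota_uniq.
move=> x xA; rewrite mem_index_iota/= (leq_trans _ leN)// ltnS.
exact: leq_bigmax_seq.
Qed.

End Topology.

(** * Pochhammer symbols and the two one-variable summations *)

Lemma geometric_partial_le (K : numFieldType) (x : K) n :
  0 <= x -> x < 1 -> \sum_(i < n) x ^+ i <= (1 - x)^-1.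
Proof.
move=> x0 x1; have y0 : 0 < 1 - x by rewrite subr_gt0.
rewrite -[leRHS]mul1r ler_pdivlMr// mulrC -opprB mulNr -subrX1 opprB.
by rewrite lerBlDr lerDl exprn_ge0.
Qed.

Lemma arith_geometric_partial_le (K : numFieldType) (x : K) n :
  0 <= x -> x < 1 -> \sum_(i < n) i.+1%:R * x ^+ i <= (1 - x)^-2.
Proof.
move=> x0 x1; have y0 : 0 < 1 - x by rewrite subr_gt0.
suff H : (1 - x) ^+ 2 * \sum_(i < n) i.+1%:R * x ^+ i =
    1 - x ^+ n * (1 + n%:R * (1 - x)).
  rewrite -[leRHS]mul1r ler_pdivlMr ?exprn_gt0// mulrC H lerBlDr lerDl.
  by rewrite mulr_ge0 ?exprn_ge0// addr_ge0// mulr_ge0// ltW.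
elim: n => [|n IH]; first by rewrite big_ord0 mul0r addr0 !mulr1 mulr0 subrr.
rewrite big_ord_recr mulrDr IH/= -natr1 (exprS x n).
by ring.
Qed.

Lemma geometric_summable (K : numFieldType) (x : K) :
  `|x| < 1 -> abs_summable (fun n => x ^+ n).
Proof.
move=> x1; apply: (@abs_summable_nat _ _ (1 - `|x|)^-1) => n.
by under eq_bigr do rewrite normrX; exact: geometric_partial_le.
Qed.

Lemma arith_geometric_summable (K : numFieldType) (x : K) :
  `|x| < 1 -> abs_summable (fun n => n.+1%:R * x ^+ n).
Proof.
move=> x1; apply: (@abs_summable_nat K _ ((1 - `|x|) ^- 2)) => n.
under eq_bigr do rewrite normrM normrX normr_nat.
exact: arith_geometric_partial_le.
Qed.

(** The factor 1 / (1 - r^j) is 1 + r^j / (1 - r^j), hence at most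
    exp (r^(j-1) / (1 - r)), and the exponents add up to a bounded geometric
    series. *)
Lemma inv_euler_prod_bounded (R : realType) (r : R) : 0 <= r -> r < 1 ->
  exists2 C : R, 0 < C & forall n, (\prod_(1 <= j < n.+1) (1 - r ^+ j))^-1 <= C.
Proof.
move=> r0 r1; have y0 : 0 < 1 - r by rewrite subr_gt0.
exists (expR ((1 - r)^-1 / (1 - r))); first exact: expR_gt0.
move=> n; apply: (@le_trans _ _ (expR ((\sum_(i < n) r ^+ i) / (1 - r)))); last first.
  by rewrite ler_expR ler_pM2r ?invr_gt0// geometric_partial_le.
elim: n => [|n IH]; first by rewrite big_ord0 mul0r expR0 big_geq// invr1.
rewrite big_nat_recr//= invfM big_ord_recr/= mulrDl expRD ler_pM//.
  rewrite invr_ge0 big_nat; apply: prodr_ge0 => j _.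
  by rewrite subr_ge0 exprn_ile1// ltW.
  by rewrite invr_ge0 subr_ge0 exprn_ile1// ltW.
have rn : r ^+ n.+1 <= r by rewrite exprS ler_piMr// exprn_ile1// ltW.
have z0 : 0 < 1 - r ^+ n.+1 by rewrite subr_gt0 (le_lt_trans rn).
apply: le_trans (expR_ge1Dx _).
rewrite -[leLHS]mul1r ler_pdivrMr//.
have h : r ^+ n.+1 <= r ^+ n / (1 - r) * (1 - r ^+ n.+1).
  rewrite mulrAC ler_pdivlMr//; apply: ler_pM => //.
  - exact: exprn_ge0.
  - exact: ltW.
  - by rewrite exprS ler_piMl// ?exprn_ge0// ltW.
  - by rewrite lerD2l lerN2.
by rewrite mulrDl mul1r -[leLHS](subrK (r ^+ n.+1)) lerD2l.
Qed.

Section QPochhammer.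
Variables (R : realType) (q : R[i]).
Hypothesis q_lt1 : `|q| < 1.
Local Notation P := (qpoch q).

Lemma subr1X_neq0 n : 1 - q ^+ n.+1 != 0.
Proof.
rewrite subr_eq0; apply: contraTneq q_lt1 => /(congr1 (fun z => `|z|)).
rewrite normr1 normrX => h; rewrite -real_leNgt ?normr_real//.
by rewrite -(@expr_ge1 _ n.+1)// -h.
Qed.

Lemma qpoch0 : P 0 = 1.
Proof. by rewrite /qpoch big_geq. Qed.

Lemma qpochS n : P n.+1 = P n * (1 - q ^+ n.+1).
Proof. by rewrite /qpoch big_nat_recr. Qed.

Lemma qpoch_neq0 n : P n != 0.
Proof.
elim: n => [|n IH]; first by rewrite qpoch0 oner_neq0.
by rewrite qpochS mulf_neq0// subr1X_neq0.
Qed.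

(** With r = |q|, each factor satisfies 1 - r^j <= |1 - q^j| <= 1 + r^j, and
    1 + r^j <= 1 / (1 - r^j); both bounds thus reduce to that of the inverse
    Euler product of r. *)
Lemma qpoch_bounded :
  exists C : R[i], forall n, `|P n| <= C /\ `|(P n)^-1| <= C.
Proof.
have [r qr] : exists r, `|q| = r%:C%C.
  by apply/complex_realP; exact: normr_real.
have r0 : 0 <= r by rewrite -lecR -qr normr_ge0.
have r1 : r < 1 by rewrite -ltcR -qr.
have [C C0 hC] := inv_euler_prod_bounded r0 r1.
have f0 n : 0 < 1 - `|q| ^+ n.+1 by rewrite subr_gt0 exprn_ilt1.
have hC' n : (\prod_(1 <= j < n.+1) (1 - `|q| ^+ j))^-1 <= C%:C%C.
  have := hC n; rewrite -lecR fmorphV rmorph_prod/=.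
  by under eq_bigr do rewrite rmorphB rmorph1 rmorphXn/= -qr.
exists C%:C%C => n; split; apply: le_trans (hC' n).
  elim: n => [|n IH]; first by rewrite qpoch0 big_geq// invr1 normr1.
  rewrite qpochS big_nat_recr//= normrM invfM ler_pM//.
  rewrite -[leRHS]mul1r ler_pdivlMr//.
  apply: (@le_trans _ _ ((1 + `|q| ^+ n.+1) * (1 - `|q| ^+ n.+1))).
    rewrite ler_pM2r// (le_trans (ler_normB _ _))// normr1 normrX//.
  rewrite mulrC -subr_sqr expr1n lerBlDr lerDl exprn_ge0// exprn_ge0//.
elim: n => [|n IH]; first by rewrite qpoch0 big_geq// invr1 normr1.
rewrite qpochS big_nat_recr//= normfV normrM !invfM -normfV ler_pM ?invr_ge0//.
rewrite lef_pV2 ?posrE ?normr_gt0 ?subr1X_neq0//.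
by rewrite (le_trans _ (lerB_dist _ _))// normr1 normrX.
Qed.

Lemma qexp_summable : abs_summable (fun n => q ^+ n / P n).
Proof.
have [C hC] := qpoch_bounded.
have C0 : 0 <= C by case: (hC 0%N) => h _; exact: le_trans h.
apply: (abs_summable_le C0 _ (geometric_summable q_lt1)) => n.
by rewrite normrM mulrC ler_wpM2r//; case: (hC n).
Qed.

Lemma sum_qexp n : \sum_(0 <= k < n.+1) q ^+ k / P k = (P n)^-1.
Proof.
elim: n => [|n IH]; first by rewrite big_nat1 expr0 mul1r.
rewrite big_nat_recr//= IH qpochS.
by field; rewrite qpoch_neq0 subr1X_neq0.
Qed.

(** The partial sums of q^n / (q)_n telescope to 1 / (q)_N, so the absolute
    convergence of this series gives the convergence of 1 / (q)_N.  Its limit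
    is nonzero because (q)_N is bounded. *)
Lemma qpoch_infP :
  qpoch_inf q != 0 /\ has_sum (fun n => q ^+ n / P n) (qpoch_inf q)^-1.
Proof.
have [s hs] := abs_summable_has_sum qexp_summable.
have cvgs : (P n)^-1 @[n --> \oo] --> s.
  under eq_fun do rewrite -sum_qexp.
  have := has_sum_series hs; rewrite -cvg_shiftS; exact.
have s0 : s != 0.
  apply/eqP => s0; have [C hC] := qpoch_bounded.
  have C0 : 0 < C.
    by case: (hC 0%N) => h _; apply: lt_le_trans h; rewrite normr_gt0 qpoch_neq0.
  move/cvgrPdist_lt : cvgs => /(_ C^-1); rewrite invr_gt0 => /(_ C0)[N _ hN].
  have := hN N (leqnn _); rewrite s0 sub0r normrN normfV.
  rewrite ltf_pV2 ?posrE// ?normr_gt0 ?qpoch_neq0// => CN.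
  by have := lt_le_trans CN (hC N).1; rewrite ltxx.
have -> : qpoch_inf q = s^-1.
  apply: cvg_lim; first exact: norm_hausdorff.
  rewrite (_ : qpoch q = (fun n => ((P n)^-1)^-1)); first exact: cvgV.
  by apply/funext => n; rewrite invrK.
by rewrite invr_neq0// invrK.
Qed.

Lemma has_sum_shift (f : nat -> R[i]) s :
  has_sum f s -> has_sum (fun n => if n is k.+1 then f k else 0) s.
Proof.
move=> fs; apply: (@has_sum_inj _ _ _ S) => //; first exact: succn_inj.
by case=> [//|n] /(_ n).
Qed.

(** Euler's identity at z = q^(m+1).  Since q^n = 1 - (1 - q^n), the term of
    index n for m + 1 is the one for m minus a term in which 1 - q^n cancels
    against (q)_n, namely q^(m+1) times the term of index n - 1 for m.  So each
    step from m to m + 1 multiplies the sum by 1 - q^(m+1), starting from the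
    value 1 / (q)_oo at m = 0. *)
Lemma has_sum_qexp m :
  has_sum (fun n => q ^+ (n * m.+1) / P n) (P m / qpoch_inf q).
Proof.
elim: m => [|m IH].
  rewrite qpoch0 mul1r; apply: eq_has_sum qpoch_infP.2 => n.
  by rewrite muln1.
have := has_sumB IH (has_sumZ (q ^+ m.+1) (has_sum_shift IH)).
rewrite (_ : P m / _ - _ = P m.+1 / qpoch_inf q); last by rewrite qpochS; ring.
apply: eq_has_sum => -[|n]; first by rewrite !mul0n mulr0 subr0.
rewrite [(n.+1 * m.+2)%N]mulnS !mulSn !exprD qpochS.
move: (P n) (q ^+ n.+1) (q ^+ m.+1) (q ^+ (n * m.+1)) (qpoch_neq0 n) (subr1X_neq0 n).
by move=> p x y z p0 x0; field; rewrite p0 x0.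
Qed.

Lemma has_sum_geometric (z : R[i]) : `|z| < 1 ->
  has_sum (fun n => z ^+ n) (1 - z)^-1.
Proof.
move=> z1; have [s hs] := abs_summable_has_sum (geometric_summable z1).
have h : has_sum (fun n : nat => if n is 0%N then 1 : R[i] else 0) 1.
  have := @has_sum_finite R[i] _
    (fun n : nat => if n is 0%N then 1 : R[i] else 0) [:: 0%N] isT.
  by rewrite big_seq1; apply; case.
suff e : s = 1 + z * s.
  suff -> : (1 - z)^-1 = s by [].
  have z0 : 1 - z != 0.
    rewrite subr_eq0; apply: contraTneq z1 => <-; by rewrite normr1 ltxx.
  apply: (mulfI z0); rewrite mulfV// mulrBl mul1r {1}e; ring.
apply: (has_sum_unique hs).
have := has_sumD h (has_sumZ z (has_sum_shift hs)).
apply: eq_has_sum => -[|n]; first by rewrite mulr0 addr0.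
by rewrite add0r exprS.
Qed.

(** The q-binomial theorem at z = q^(b+1), for which the infinite products of
    the general case collapse to finite ones.  Induction on a for all b at once:
    (q)_(a+1+c) is (q)_(a+c) (1 - q^(a+1) q^c), and the factor q^c raises b
    by one. *)
Lemma has_sum_qbinomial a b :
  has_sum (fun c => q ^+ (c * b.+1) * P (a + c) / P c)
    (P a * P b / P (a + b).+1).
Proof.
elim: a b => [|a IH] b.
  have qb : `|q ^+ b.+1| < 1 by rewrite normrX exprn_ilt1.
  have := has_sum_geometric qb.
  rewrite (_ : _^-1 = P 0 * P b / P (0 + b).+1); last first.
    by rewrite qpoch0 add0n qpochS; field; rewrite qpoch_neq0 subr1X_neq0.
  apply: eq_has_sum => c; rewrite -exprM mulnC add0n mulfK//.
  exact: qpoch_neq0.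
have := has_sumB (IH b) (has_sumZ (q ^+ a.+1) (IH b.+1)).
rewrite (_ : _ - _ = P a.+1 * P b / P (a.+1 + b).+1); last first.
  rewrite addnS addSn (qpochS (a + b).+1) (qpochS a) (qpochS b).
  have xy := subr1X_neq0 (a + b).+1; move: xy.
  rewrite (_ : (a + b).+2 = a.+1 + b.+1)%N ?exprD; last by rewrite addSn addnS.
  move: (P a) (P b) (P _) (qpoch_neq0 (a + b).+1) (q ^+ a.+1) (q ^+ b.+1).
  by move=> u v w w0 x y xy; field; rewrite w0 xy.
apply: eq_has_sum => c; rewrite addSn qpochS -addSn exprD.
rewrite [(c * b.+2)%N]mulnS exprD; field.
exact: qpoch_neq0.
Qed.

End QPochhammer.

(** * Summation along the fibres of a map *)

Section Fibers.
Variable K : numFieldType.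

(** Fubini on the graph of p, seen inside J * I.  The fibres are finite and
    given by the enumerations r j. *)
Lemma has_sum_fiber (I J : eqType) (p : I -> J) (f : I -> K) (r : J -> seq I) s :
  (forall j, uniq (r j)) -> (forall i j, (i \in r j) = (p i == j)) ->
  has_sum f s -> has_sum (fun j => \sum_(i <- r j) f i) s.
Proof.
move=> ur rP fs.
pose F (x : J * I) := if p x.2 == x.1 then f x.2 else 0.
apply: (@has_sum_fubini _ _ _ F).
  apply: (@has_sum_inj _ _ _ (fun i => (p i, i))) => [i i' []//|[j i] nij|].
    by rewrite /F/=; case: eqP => // pij; case: (nij i); rewrite pij.
  by apply: eq_has_sum fs => i; rewrite /F/= eqxx.
move=> j; rewrite (_ : \sum_(i <- r j) f i = \sum_(i <- r j) F (j, i)).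
  by apply: has_sum_finite => // i; rewrite rP /F/= => /negPf ->.
by apply: eq_big_seq => i; rewrite rP /F/= => ->.
Qed.

Lemma has_sum_diagonal (f : nat * nat -> K) s :
  has_sum f s ->
  has_sum (fun n => \sum_(0 <= m < n.+1) f (m, (n - m)%N)) s.
Proof.
pose r n := [seq (m, (n - m)%N) | m <- iota 0 n.+1].
move=> fs; have h := @has_sum_fiber _ _ (fun x : nat * nat => x.1 + x.2)%N f r s.
apply: eq_has_sum (h _ _ fs) => [n|n|[a b] n].
- by rewrite big_map.
- by rewrite map_inj_uniq ?iota_uniq// => a b [].
- apply/mapP/eqP => [[m]|/= <-]; first by rewrite mem_iota => mn [-> ->]/=; lia.
  have ain : a \in iota 0 (a + b).+1 by rewrite mem_iota add0n ltnS leq_addr.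
  by exists a; rewrite ?addKn.
Qed.

Lemma has_sum_diagonal_pair (I : eqType) (f : nat * nat * I -> K) s :
  has_sum f s ->
  has_sum (fun x : nat * I =>
    \sum_(0 <= m < x.1.+1) f ((m, (x.1 - m)%N), x.2)) s.
Proof.
pose r (x : nat * I) := [seq ((m, (x.1 - m)%N), x.2) | m <- iota 0 x.1.+1].
move=> fs; have h := @has_sum_fiber _ _
  (fun x : nat * nat * I => (x.1.1 + x.1.2, x.2))%N f r s.
apply: eq_has_sum (h _ _ fs) => [n|n|[[a b] i] [n j]].
- by rewrite big_map.
- by rewrite map_inj_uniq ?iota_uniq// => a b [].
- apply/mapP/eqP => [[m]|/= [<- <-]].
    by rewrite mem_iota/= => mn [-> -> ->]/=; congr pair; lia.
  have ain : a \in iota 0 (a + b).+1 by rewrite mem_iota add0n ltnS leq_addr.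
  by exists a; rewrite ?addKn.
Qed.

End Fibers.

(** * Summing out the vertices of C_5 and Gamma_8 *)

(** Multi-indices are nested pairs, so that the last variable is always the
    second component of a product and Fubini applies to it. *)
Local Notation nat2 := (nat * nat)%type.
Local Notation nat3 := (nat2 * nat)%type.
Local Notation nat4 := (nat3 * nat)%type.
Local Notation nat5 := (nat4 * nat)%type.
Local Notation nat6 := (nat5 * nat)%type.
Local Notation nat7 := (nat6 * nat)%type.
Local Notation nat8 := (nat7 * nat)%type.

Section GraphSums.
Variables (R : realType) (q : R[i]).
Hypothesis q_lt1 : `|q| < 1.
Local Notation P := (qpoch q).
Local Notation Poo := (qpoch_inf q).

Let Poo_neq0 : Poo != 0 := (qpoch_infP q_lt1).1.

Lemma summable_add_vertex (I : eqType) (f : I -> R[i]) (m : I -> nat) :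
  abs_summable f ->
  abs_summable (fun x : I * nat => f x.1 * (q ^+ (x.2 * (m x.1).+1) / P x.2)).
Proof.
move=> sf; apply: (abs_summable_le ler01 _ (abs_summable_prod sf (qexp_summable q_lt1))).
move=> [i n] /=; rewrite mul1r !normrM ler_wpM2l// ler_wpM2r// !normrX mulnS exprD.
by rewrite ler_piMr ?exprn_ge0// exprn_ile1// ltW.
Qed.

(** Sums out a vertex whose neighbours carry the total weight m i; the product f
    collects all factors that do not depend on that vertex. *)
Lemma sum_over_vertex (I : eqType) (F : I * nat -> R[i]) (G f : I -> R[i])
    (m : I -> nat) s :
  (forall i n, F (i, n) = f i * (q ^+ (n * (m i).+1) / P n)) ->
  (forall i, G i = f i * (P (m i) / Poo)) ->
  has_sum F s -> has_sum G s.
Proof.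
move=> FE GE /has_sum_fubini; apply => i; rewrite GE.
by apply: eq_has_sum (has_sumZ (f i) (has_sum_qexp q_lt1 _)) => n; rewrite FE.
Qed.

Lemma sum_over_qbinomial (I : eqType) (F : I * nat -> R[i]) (G f : I -> R[i])
    (a b : I -> nat) s :
  (forall i n, F (i, n) =
     f i * (q ^+ (n * (b i).+1) * P (a i + n) / P n)) ->
  (forall i, G i = f i * (P (a i) * P (b i) / P (a i + b i).+1)) ->
  has_sum F s -> has_sum G s.
Proof.
move=> FE GE /has_sum_fubini; apply => i; rewrite GE.
by apply: eq_has_sum (has_sumZ (f i) (has_sum_qbinomial q_lt1 _ _)) => n; rewrite FE.
Qed.

Local Notation u n := (q ^+ n / P n).
(** The general term for C_5 with (n_2, n_5, n_4, n_3, n_1) = (a, b, c, d, e).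
    Each variable comes with the edges that join it to the preceding ones, so
    that the vertices can be summed out from the last one backwards. *)
Definition C5_summand (x : nat5) : R[i] :=
  let: (a, b, c, d, e) := x in
  u a * u b * (q ^+ (c * b.+1) / P c) * (q ^+ (d * (a + c).+1) / P d)
      * (q ^+ (e * (a + b).+1) / P e).

Lemma C5_summable : abs_summable C5_summand.
Proof.
have h2 := abs_summable_prod (qexp_summable q_lt1) (qexp_summable q_lt1).
have h3 := summable_add_vertex (fun x : nat2 => x.2) h2.
have h4 := summable_add_vertex (fun x : nat3 => x.1.1 + x.2)%N h3.
have h5 := summable_add_vertex (fun x : nat4 => x.1.1.1 + x.1.1.2)%N h4.
by apply: (abs_summable_le ler01 _ h5) => -[[[[a b] c] d] e]; rewrite mul1r.
Qed.

Lemma C5_reduction s : has_sum C5_summand s ->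
  has_sum (fun x : nat2 =>
    Poo ^- 2 * (q ^+ (x.1 + x.2) / (1 - q ^+ (x.1 + x.2).+1))) s.
Proof.
move=> h5.
have h4 : has_sum (fun '((a, b, c, d) : nat4) =>
    u a * u b * (q ^+ (c * b.+1) / P c) * (q ^+ (d * (a + c).+1) / P d)
        * (P (a + b) / Poo)) s.
  by apply: (@sum_over_vertex nat4 _ _ (fun '(a, b, c, d) =>
      u a * u b * (q ^+ (c * b.+1) / P c) * (q ^+ (d * (a + c).+1) / P d))
    (fun '(a, b, c, d) => (a + b)%N) s _ _ h5) => -[[[a b] c] d].
have h3 : has_sum (fun '((a, b, c) : nat3) =>
    u a * u b * (q ^+ (c * b.+1) / P c) * (P (a + b) / Poo)
        * (P (a + c) / Poo)) s.
  apply: (@sum_over_vertex nat3 _ _ (fun '(a, b, c) =>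
      u a * u b * (q ^+ (c * b.+1) / P c) * (P (a + b) / Poo))
    (fun '(a, b, c) => (a + c)%N) s _ _ h4) => -[[a b] c]// d.
  exact: mulrAC.
apply: (@sum_over_qbinomial nat2 _ _ (fun '(a, b) =>
    u a * u b * (P (a + b) / Poo ^+ 2)) fst snd s _ _ h3) => [[a b] c|[a b]] /=.
  by field; rewrite !(qpoch_neq0 q_lt1) Poo_neq0.
rewrite qpochS exprD.
by field; rewrite !(qpoch_neq0 q_lt1) Poo_neq0 subr1X_neq0.
Qed.

(** The general term for Gamma_8 with
    (n_2, n_6, n_5, n_7, n_4, n_8, n_3, n_1) = (a, b, c, d, e, g, h, i).
    The last three vertices 8, 3, 1 are pairwise non-adjacent; after they are
    gone, 4 and 7 are summed by the q-binomial theorem. *)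
Definition Gamma8_summand (x : nat8) : R[i] :=
  let: (a, b, c, d, e, g, h, i) := x in
  u a * u b * u c * (q ^+ (d * a.+1) / P d) * (q ^+ (e * c.+1) / P e)
      * (q ^+ (g * (d + b).+1) / P g) * (q ^+ (h * (a + e + b).+1) / P h)
      * (q ^+ (i * (a + b + c).+1) / P i).

Lemma Gamma8_summable : abs_summable Gamma8_summand.
Proof.
have u_summable := qexp_summable q_lt1.
have h3 := abs_summable_prod (abs_summable_prod u_summable u_summable) u_summable.
have h4 := summable_add_vertex (fun x : nat3 => x.1.1) h3.
have h5 := summable_add_vertex (fun x : nat4 => x.1.2) h4.
have h6 := summable_add_vertex (fun x : nat5 => x.1.2 + x.1.1.1.2)%N h5.
have h7 := summable_add_vertex
  (fun x : nat6 => x.1.1.1.1.1 + x.1.2 + x.1.1.1.1.2)%N h6.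
have h8 := summable_add_vertex
  (fun x : nat7 => x.1.1.1.1.1.1 + x.1.1.1.1.1.2 + x.1.1.1.1.2)%N h7.
apply: (abs_summable_le ler01 _ h8) => -[[[[[[[a b] c] d] e] g] h] i].
by rewrite mul1r.
Qed.

Lemma Gamma8_reduction s : has_sum Gamma8_summand s ->
  has_sum (fun x : nat3 => let: (a, b, c) := x in
    Poo ^- 3 * (q ^+ (a + b + c) /
      ((1 - q ^+ (a + b + c).+1) * (1 - q ^+ (a + b).+1)))) s.
Proof.
move=> h8.
have h7 : has_sum (fun '((a, b, c, d, e, g, h) : nat7) =>
    u a * u b * u c * (q ^+ (d * a.+1) / P d) * (q ^+ (e * c.+1) / P e)
      * (q ^+ (g * (d + b).+1) / P g) * (q ^+ (h * (a + e + b).+1) / P h)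
      * (P (a + b + c) / Poo)) s.
  by apply: (@sum_over_vertex nat7 _ _ (fun '(a, b, c, d, e, g, h) =>
      u a * u b * u c * (q ^+ (d * a.+1) / P d) * (q ^+ (e * c.+1) / P e)
        * (q ^+ (g * (d + b).+1) / P g) * (q ^+ (h * (a + e + b).+1) / P h))
    (fun '(a, b, c, d, e, g, h) => (a + b + c)%N) s _ _ h8)
    => -[[[[[[a b] c] d] e] g] h].
have h6 : has_sum (fun '((a, b, c, d, e, g) : nat6) =>
    u a * u b * u c * (q ^+ (d * a.+1) / P d) * (q ^+ (e * c.+1) / P e)
      * (q ^+ (g * (d + b).+1) / P g)
      * (P (a + b + c) / Poo) * (P (a + e + b) / Poo)) s.
  apply: (@sum_over_vertex nat6 _ _ (fun '(a, b, c, d, e, g) =>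
      u a * u b * u c * (q ^+ (d * a.+1) / P d) * (q ^+ (e * c.+1) / P e)
        * (q ^+ (g * (d + b).+1) / P g) * (P (a + b + c) / Poo))
    (fun '(a, b, c, d, e, g) => (a + e + b)%N) s _ _ h7)
    => -[[[[[a b] c] d] e] g]// h.
  exact: mulrAC.
have h5 : has_sum (fun '((a, b, c, d, e) : nat5) =>
    u a * u b * u c * (q ^+ (d * a.+1) / P d) * (q ^+ (e * c.+1) / P e)
      * (P (a + b + c) / Poo) * (P (a + e + b) / Poo)
      * (P (d + b) / Poo)) s.
  apply: (@sum_over_vertex nat5 _ _ (fun '(a, b, c, d, e) =>
      u a * u b * u c * (q ^+ (d * a.+1) / P d) * (q ^+ (e * c.+1) / P e)
        * (P (a + b + c) / Poo) * (P (a + e + b) / Poo))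
    (fun '(a, b, c, d, e) => (d + b)%N) s _ _ h6)
    => -[[[[a b] c] d] e]// g.
  by rewrite [RHS]mulrAC; congr (_ * _); exact: mulrAC.
have h4 : has_sum (fun '((a, b, c, d) : nat4) =>
    u a * u b * u c * (q ^+ (d * a.+1) / P d)
      * (P (a + b + c) / Poo) * (P (b + d) / Poo) / Poo
      * (P (a + b) * P c / P (a + b + c).+1)) s.
  apply: (@sum_over_qbinomial nat4 _ _ (fun '(a, b, c, d) =>
      u a * u b * u c * (q ^+ (d * a.+1) / P d)
      * (P (a + b + c) / Poo) * (P (b + d) / Poo) / Poo)
    (fun '(a, b, c, d) => a + b)%N (fun '(a, b, c, d) => c) s _ _ h5)
    => -[[[a b] c] d]// e.
  rewrite (addnAC a e b) (addnC d b).
  by field; rewrite !(qpoch_neq0 q_lt1) Poo_neq0.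
apply: (@sum_over_qbinomial nat3 _ _ (fun '(a, b, c) =>
    u a * u b * u c * (P (a + b + c) / Poo ^+ 3)
      * (P (a + b) * P c / P (a + b + c).+1))
  (fun '(a, b, c) => b) (fun '(a, b, c) => a) s _ _ h4)
  => -[[a b] c] => [d|].
  by field; rewrite !(qpoch_neq0 q_lt1) Poo_neq0.
rewrite (addnC b a) !qpochS !exprD.
by field; rewrite !(qpoch_neq0 q_lt1) Poo_neq0 !subr1X_neq0.
Qed.

End GraphSums.

(** * Multi-indices as lists *)

Definition row_of_seq r (s : seq nat) : 'rV[nat]_r := \row_(i < r) nth 0 s i.

Lemma row_of_seq_inj r (s t : seq nat) : size s = r -> size t = r ->
  row_of_seq r s = row_of_seq r t -> s = t.
Proof.
move=> sr tr /rowP st; apply: (@eq_from_nth _ 0) => [|i]; first by rewrite tr.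
by rewrite sr => ir; have := st (Ordinal ir); rewrite !mxE.
Qed.

Lemma row_of_seq_surj r (v : 'rV[nat]_r) :
  exists2 s, size s = r & row_of_seq r s = v.
Proof.
exists [seq v ord0 i | i <- enum 'I_r]; first by rewrite size_map size_enum_ord.
apply/rowP => i; rewrite mxE (nth_map i) ?size_enum_ord//.
by rewrite nth_ord_enum.
Qed.

Lemma graph_exponentE r (G : simple_graph r) (s : seq nat) :
  graph_exponent G (row_of_seq r s) =
  (\sum_(i < r) \sum_(j < r)
      (if (i < j) && G i j then nth 0 s i * nth 0 s j else 0)
    + \sum_(i < r) nth 0 s i)%N.
Proof.
rewrite /graph_exponent quad_formE doubleK; congr addn.
  rewrite big_mkcond/= (pair_bigA _ (fun i j : 'I_r => if _ then _ else _))/=.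
  by apply: eq_bigr => p _; rewrite !mxE.
by apply: eq_bigr => i _; rewrite mxE.
Qed.

Lemma C5_exponent a b c d e :
  graph_exponent C5 (row_of_seq 5 [:: e; a; d; c; b]) =
  (a + b + c * b.+1 + d * (a + c).+1 + e * (a + b).+1)%N.
Proof.
rewrite graph_exponentE; do !rewrite ?big_ord_recl ?big_ord0 /=.
by rewrite /edge_rel/=; ring.
Qed.

Lemma Gamma8_exponent a b c d e g h i :
  graph_exponent Gamma8 (row_of_seq 8 [:: i; a; h; e; c; b; d; g]) =
  (a + b + c + d * a.+1 + e * c.+1 + g * (d + b).+1 + h * (a + e + b).+1
     + i * (a + b + c).+1)%N.
Proof.
rewrite graph_exponentE; do !rewrite ?big_ord_recl ?big_ord0 /=.
by rewrite /edge_rel/=; ring.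
Qed.

Section Terms.
Variables (R : realType) (q : R[i]).

Lemma graph_termE r (G : simple_graph r) (s : seq nat) : size s = r ->
  graph_term G q (row_of_seq r s) =
  q ^+ graph_exponent G (row_of_seq r s) / \prod_(n <- s) qpoch q n.
Proof.
move=> sr; rewrite /graph_term; congr (_ / _).
rewrite (big_nth 0) big_mkord sr; apply: eq_bigr => i _; by rewrite mxE.
Qed.

Lemma C5_has_sum s : has_sum (C5_summand q) s -> has_sum (graph_term C5 q) s.
Proof.
move=> hs.
pose phi (x : nat5) :=
  let: (a, b, c, d, e) := x in row_of_seq 5 [:: e; a; d; c; b].
apply: (@has_sum_inj _ _ _ phi).
- move=> [[[[a b] c] d] e] [[[[a' b'] c'] d'] e'] /=.
  by move/row_of_seq_inj => /(_ erefl erefl)[-> -> -> -> ->].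
- move=> v nv; have [[|e [|a [|d [|c [|b []]]]]] // _ sv] := row_of_seq_surj v.
  by case: (nv (a, b, c, d, e)).
apply: eq_has_sum hs => -[[[[a b] c] d] e] /=.
rewrite graph_termE// C5_exponent !big_cons big_nil !invfM invr1 !exprD.
by ring.
Qed.

Lemma Gamma8_has_sum s :
  has_sum (Gamma8_summand q) s -> has_sum (graph_term Gamma8 q) s.
Proof.
move=> hs.
pose phi (x : nat8) :=
  let: (a, b, c, d, e, g, h, i) := x in row_of_seq 8 [:: i; a; h; e; c; b; d; g].
apply: (@has_sum_inj _ _ _ phi).
- move=> [[[[[[[a b] c] d] e] g] h] i].
  move=> [[[[[[[a' b'] c'] d'] e'] g'] h'] i'] /=.
  by move/row_of_seq_inj => /(_ erefl erefl)[-> -> -> -> -> -> -> ->].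
- move=> v nv; have [s' + sv] := row_of_seq_surj v.
  move: s' sv => [|i [|a [|h [|e [|c [|b [|d [|g []]]]]]]]]//= sv _.
  by case: (nv (a, b, c, d, e, g, h, i)).
apply: eq_has_sum hs => -[[[[[[[a b] c] d] e] g] h] i] /=.
rewrite graph_termE// Gamma8_exponent !big_cons big_nil !invfM invr1 !exprD.
by ring.
Qed.

End Terms.

(** * A double Lambert series *)

Section Splitting.
Variable K : numFieldType.
Implicit Type f : nat * nat -> K.

Lemma has_sum_split_column f s0 s1 :
  has_sum (fun m => f (m, 0)) s0 ->
  has_sum (fun x : nat * nat => f (x.1, x.2.+1)) s1 ->
  has_sum f (s0 + s1).
Proof.
move=> h0 h1.
have {}h0 : has_sum (fun x => if x.2 == 0 then f x else 0) s0.
  apply: (@has_sum_inj _ _ _ (fun m => (m, 0))) h0 => [m m' []//|[m [|k]]//].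
  by move=> /(_ m).
have {}h1 : has_sum (fun x => if x.2 == 0 then 0 else f x) s1.
  apply: (@has_sum_inj _ _ _ (fun x => (x.1, x.2.+1))) h1.
    by move=> [m k] [m' k'] [-> ->].
  by move=> [m [|k]]// /(_ (m, k)).
apply: eq_has_sum (has_sumD h0 h1) => x.
by case: ifP => _; rewrite ?addr0 ?add0r.
Qed.

Lemma has_sum_split_diagonal f s0 s1 s2 :
  has_sum (fun m => f (m, m)) s0 ->
  has_sum (fun x : nat * nat => f (x.1, (x.1 + x.2).+1)) s1 ->
  has_sum (fun x : nat * nat => f ((x.1 + x.2).+1, x.1)) s2 ->
  has_sum f (s0 + s1 + s2).
Proof.
move=> h0 h1 h2.
have {}h0 : has_sum (fun x => if x.1 == x.2 then f x else 0) s0.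
  apply: (@has_sum_inj _ _ _ (fun m => (m, m))).
  - by move=> m m' [].
  - by move=> [m k] /= mk; case: eqP => // e; case: (mk m); rewrite -e.
  - by apply: eq_has_sum h0 => m; rewrite /= eqxx.
have {}h1 : has_sum (fun x => if (x.1 < x.2)%N then f x else 0) s1.
  apply: (@has_sum_inj _ _ _ (fun x => (x.1, (x.1 + x.2).+1))).
  - by move=> [m k] [m' k'] [-> /eqP]; rewrite /= eqn_add2l => /eqP ->.
  - move=> [m k] /= mk; case: ltnP => // e; case: (mk (m, k - m.+1)%N).
    by rewrite /= -addSn subnKC.
  - by apply: eq_has_sum h1 => -[m k]; rewrite /= ltnS leq_addr.
have {}h2 : has_sum (fun x => if (x.2 < x.1)%N then f x else 0) s2.
  apply: (@has_sum_inj _ _ _ (fun x => ((x.1 + x.2).+1, x.1))).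
  - by move=> [m k] [m' k'] [h m_eq]; congr pair; move: h; rewrite /= ?m_eq; lia.
  - move=> [m k] /= mk; case: ltnP => // e; case: (mk (k, m - k.+1)%N).
    by rewrite /= -addSn subnKC.
  - by apply: eq_has_sum h2 => -[m k]; rewrite /= ltnS leq_addr.
apply: eq_has_sum (has_sumD (has_sumD h0 h1) h2) => -[m k] /=.
by case: ltngtP; rewrite ?addr0 ?add0r.
Qed.

End Splitting.

Section Lambert.
Variables (R : realType) (q : R[i]).
Hypothesis q_lt1 : `|q| < 1.
Local Notation X n := (q ^+ n.+1 / (1 - q ^+ n.+1)).

Lemma lambert_mul m k :
  X m * X k = X (m + k).+1 * (1 + X m + X k).
Proof.
have := subr1X_neq0 q_lt1 (m + k).+1.
rewrite (_ : (m + k).+2 = m.+1 + k.+1)%N ?exprD; last by rewrite addSn addnS.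
move: (q ^+ m.+1) (q ^+ k.+1) (subr1X_neq0 q_lt1 m) (subr1X_neq0 q_lt1 k).
by move=> x y x0 y0 xy0; field; rewrite x0 y0 xy0.
Qed.

Lemma lambert_norm_le m k : `|X (m + k)| <= (1 - `|q|)^-1 * `|q ^+ m|.
Proof.
have y0 : 0 < 1 - `|q| by rewrite subr_gt0.
rewrite normrM mulrC ler_pM//.
  rewrite normfV lef_pV2 ?posrE ?normr_gt0 ?subr1X_neq0//.
  rewrite (le_trans _ (lerB_dist _ _))// normr1 lerD2l lerN2 normrX.
  by rewrite exprS ler_piMr// exprn_ile1// ltW.
by rewrite !normrX -addnS exprD ler_piMr ?exprn_ge0// exprn_ile1// ltW.
Qed.

(** With X_m = x_(m+1), let P, E be the sums over m of (m+1) X_m and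
    (m+1) X_m^2, and B, C, D the sums over (m, k) of (m+1) X_(m+k+1) times
    X_m, X_k and 1.  The sum over (m, k) of (m+1) X_m X_k is
    - D + B + C, by [lambert_mul];
    - E + B + (B + C), by splitting it into m = k, m < k and m > k, where in
      the last case m = k + l + 1 and m + 1 = (k+1) + (l+1).
    Hence D = E + B.  The given sum is (P + E) + (D + B), according to whether
    the second index vanishes, that is P + 2 D; and the coefficient of X_n in
    P + 2 D is (n+1) + n (n+1) = (n+1)^2. *)
Lemma lambert_double_sum t :
  has_sum (fun x : nat * nat => x.1.+1%:R * (X (x.1 + x.2) * (1 + X x.1))) t ->
  has_sum (fun n => n.+1%:R ^+ 2 * X n) t.
Proof.
move=> ht; set c := (1 - `|q|)^-1.
have c0 : 0 <= c by rewrite invr_ge0 subr_ge0 ltW.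
have g1 := arith_geometric_summable q_lt1.
have g2 := abs_summable_prod g1 (geometric_summable q_lt1).
have sum1 (f : nat -> R[i]) k : 0 <= k -> (forall m, `|f m| <= k * `|q ^+ m|) ->
    exists s, has_sum (fun m => m.+1%:R * f m) s.
  move=> k0 fk; apply: abs_summable_has_sum; apply: (abs_summable_le k0 _ g1) => m.
  by rewrite normrM [in leRHS]normrM mulrCA ler_wpM2l.
(* Every double sum below is dominated by that of (m+1) q^m q^k. *)
have sum2 (f : nat * nat -> R[i]) :
    (forall x, `|f x| <= c * `|q ^+ x.1| * (c * `|q ^+ x.2|)) ->
    exists s, has_sum (fun x => x.1.+1%:R * f x) s.
  move=> fc; apply: abs_summable_has_sum.
  apply: (abs_summable_le (mulr_ge0 c0 c0) _ g2) => x.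
  rewrite normrM -[_ * q ^+ _ * _]mulrA [in leRHS]normrM [leRHS]mulrCA ler_wpM2l//.
  by rewrite normrM mulrACA.
have Xc n : `|X n| <= c * `|q ^+ n| by have := lambert_norm_le n 0; rewrite addn0.
have c1 : 1 <= c by rewrite invf_ge1 ?subr_gt0// gerBl.
have Xm m k : `|X (m + k).+1| <= c * `|q ^+ m|.
  by rewrite -addnS; exact: lambert_norm_le.
have Xk m k : `|X (m + k).+1| <= c * `|q ^+ k| by rewrite addnC.
have [p hp] := sum1 (fun m => X m) c c0 Xc.
have [e he] : exists s, has_sum (fun m => m.+1%:R * (X m * X m)) s.
  apply: (sum1 (fun m => X m * X m) (c * c)) => [|m]; first exact: mulr_ge0.
  rewrite normrM -mulrA mulrC ler_pM// (le_trans (Xc m))// normrX.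
  by rewrite ler_piMr// exprn_ile1// ltW.
have [b hb] : exists s, has_sum
    (fun x : nat * nat => x.1.+1%:R * (X (x.1 + x.2).+1 * X x.1)) s.
  apply: (sum2 (fun x => X (x.1 + x.2).+1 * X x.1)) => x.
  by rewrite normrM mulrC ler_pM.
have [c' hc] : exists s, has_sum
    (fun x : nat * nat => x.1.+1%:R * (X (x.1 + x.2).+1 * X x.2)) s.
  apply: (sum2 (fun x => X (x.1 + x.2).+1 * X x.2)) => x.
  by rewrite normrM ler_pM.
have [d hd] : exists s, has_sum
    (fun x : nat * nat => x.1.+1%:R * X (x.1 + x.2).+1) s.
  apply: (sum2 (fun x => X (x.1 + x.2).+1)) => x.
  have := lambert_norm_le (x.1 + x.2) 1; rewrite addn1 -/c => /le_trans; apply.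
  rewrite exprD normrM [leLHS]mulrA ler_wpM2l//; first by rewrite mulr_ge0.
  by rewrite -[leLHS]mul1r ler_wpM2r.
have de : d = e + b.
  have split_product : has_sum
      (fun x : nat * nat => x.1.+1%:R * (X x.1 * X x.2)) (e + b + (b + c')).
    apply: has_sum_split_diagonal => //=.
      by apply: eq_has_sum hb => x; congr (_ * _); rewrite mulrC.
    have hc_swap : has_sum
        (fun x : nat * nat => x.2.+1%:R * (X (x.1 + x.2).+1 * X x.1)) c'.
      apply: (@has_sum_inj _ _ _ (fun x : nat * nat => (x.2, x.1))).
      - by move=> [m k] [m' k'] [-> ->].
      - by move=> [m k] /(_ (k, m)).
      - by apply: eq_has_sum hc => -[m k] /=; rewrite (addnC k m).
    apply: eq_has_sum (has_sumD hb hc_swap) => x.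
    by rewrite -mulrDl -natrD addSn addnS.
  have expand_product : has_sum
      (fun x : nat * nat => x.1.+1%:R * (X x.1 * X x.2)) (d + b + c').
    apply: eq_has_sum (has_sumD (has_sumD hd hb) hc) => x.
    by rewrite [in RHS]lambert_mul !mulrDr mulr1.
  have := has_sum_unique split_product expand_product.
  by rewrite !addrA => /addIr/addIr.
have -> : t = p + d + d.
  have : has_sum (fun x : nat * nat =>
      x.1.+1%:R * (X (x.1 + x.2) * (1 + X x.1))) (p + e + (d + b)).
    apply: has_sum_split_column => /=.
      apply: eq_has_sum (has_sumD hp he) => m.
      by rewrite addn0 mulrDr mulr1 mulrDr.
    apply: eq_has_sum (has_sumD hd hb) => x.
    by rewrite addnS [in RHS]mulrDr mulr1 mulrDr.
  by move=> /(has_sum_unique ht) ->; rewrite de; ring.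
have hd' : has_sum (fun n => (\sum_(0 <= m < n) m.+1%:R) * X n) d.
  apply: eq_has_sum (has_sum_shift (has_sum_diagonal hd)) => -[|n].
    by rewrite big_geq// mul0r.
  rewrite mulr_suml; apply: eq_big_nat => m /andP[_ mn].
  by rewrite /= subnKC.
apply: eq_has_sum (has_sumD (has_sumD hp hd') hd') => n.
(* D collected along m + k + 1 = n has the coefficient 1 + ... + n. *)
have gauss : \sum_(0 <= m < n) m.+1%:R *+ 2 = n%:R * n.+1%:R :> R[i].
  elim: n => [|n IH]; first by rewrite big_geq// mul0r.
  by rewrite big_nat_recr//= IH -!natr1; ring.
rewrite -!mulrDl -addrA -mulr2n -sumrMnl gauss; congr (_ * _).
by rewrite -natr1; ring.
Qed.

End Lambert.

(** * Evaluation of the two graph series *)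

Section Assembly.
Variables (R : realType) (q : R[i]).
Hypotheses (q_gt0 : 0 < `|q|) (q_lt1 : `|q| < 1).
Local Notation Poo := (qpoch_inf q).

Lemma series_from1 (F : nat -> R[i]) s :
  has_sum (fun n => F n.+1) s -> \big[+%R/0]_(1 <= n <oo) F n = s.
Proof.
move=> hF; apply: cvg_lim; first exact: norm_hausdorff.
rewrite (_ : (fun N => _) =
    fun N => \sum_(0 <= n < N) (if n is k.+1 then F k.+1 else 0)).
  exact: has_sum_series (has_sum_shift hF).
apply/funext => -[|N]; first by rewrite !big_geq.
rewrite [RHS]big_ltn// add0r; apply: eq_big_nat => n /andP[n1 _].
by case: n n1.
Qed.

Lemma C5_value s : has_sum (C5_summand q) s ->
  s = q^-1 / Poo ^+ 2 *
      \big[+%R/0]_(1 <= n <oo) (n%:R * q ^+ n / (1 - q ^+ n)).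
Proof.
move=> /(C5_reduction q_lt1)/has_sum_diagonal hs.
have q0 : q != 0 by rewrite -normr_gt0.
have [Poo0 _] := qpoch_infP q_lt1.
rewrite (@series_from1 _ (q * Poo ^+ 2 * s)); first by field; rewrite q0 Poo0.
apply: eq_has_sum (has_sumZ _ hs) => n.
under eq_big_nat => m /andP[_ mn] do rewrite /= subnKC//.
rewrite sumr_const_nat subn0 -[_ *+ n.+1]mulr_natl.
move: (subr1X_neq0 q_lt1 n); rewrite (exprS q n) => n0.
by field; rewrite Poo0 n0.
Qed.

Lemma Gamma8_value s : has_sum (Gamma8_summand q) s ->
  s = q^-1 / Poo ^+ 3 *
      \big[+%R/0]_(1 <= n <oo) (n%:R ^+ 2 * q ^+ n / (1 - q ^+ n)).
Proof.
move=> /(Gamma8_reduction q_lt1)/has_sum_diagonal_pair hs.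
have q0 : q != 0 by rewrite -normr_gt0.
have [Poo0 _] := qpoch_infP q_lt1.
rewrite (@series_from1 _ (q * Poo ^+ 3 * s)); first by field; rewrite q0 Poo0.
suff : has_sum (fun n => n.+1%:R ^+ 2 * (q ^+ n.+1 / (1 - q ^+ n.+1)))
    (q * Poo ^+ 3 * s).
  by apply: eq_has_sum => n; rewrite mulrA.
apply: (lambert_double_sum q_lt1).
apply: eq_has_sum (has_sumZ _ hs) => -[m k] /=.
under eq_big_nat => a /andP[_ am] do rewrite /= subnKC//.
rewrite sumr_const_nat subn0 -[_ *+ m.+1]mulr_natl (exprS q (m + k)).
move: (subr1X_neq0 q_lt1 (m + k)) (subr1X_neq0 q_lt1 m).
rewrite (exprS q (m + k)) => mk0 m0.
by field; rewrite Poo0 mk0 m0.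
Qed.

End Assembly.

Theorem theorem1p3 (R : realType) (q : R[i]) (q_gt0 : 0 < `|q|)
    (q_lt1 : `|q| < 1) :
  [/\ cvg (partial_sum (graph_term C5 q) @ totally),
      graph_series C5 q =
        q^-1 / qpoch_inf q ^+ 2 *
        \big[+%R/0]_(1 <= n <oo) (n%:R * q ^+ n / (1 - q ^+ n)),
      cvg (partial_sum (graph_term Gamma8 q) @ totally)
    & graph_series Gamma8 q =
        q^-1 / qpoch_inf q ^+ 3 *
        \big[+%R/0]_(1 <= n <oo) (n%:R ^+ 2 * q ^+ n / (1 - q ^+ n))].
Proof.
have [s hs] := abs_summable_has_sum (C5_summable q_lt1).
have [t ht] := abs_summable_has_sum (Gamma8_summable q_lt1).
split.
- exact: cvgP (has_sum_totally (C5_has_sum hs)).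
- by rewrite /graph_series (has_sum_sum (C5_has_sum hs)); exact: C5_value.
- exact: cvgP (has_sum_totally (Gamma8_has_sum ht)).
- by rewrite /graph_series (has_sum_sum (Gamma8_has_sum ht)); exact: Gamma8_value.
Qed.
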